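(* Let $G$ be a normal operator on a Hilbert space whose spectrum lies on finitely many rays $e^{i\theta_j}\mathbb{R}_{\ge0}$ with $0\le\theta_j<2\pi$, $j=1,\dots,n$. Let $T=G+S$ where $S$ is $p$-subordinate to $G$ with $p$-subordination bound $b$ and $0\le p<1$. Then for every $\alpha>b$ there exists $r_0>0$ such that $$\sigma(T)\subset B_{r_0}(0)\cup\bigcup_{j=1}^n\{e^{i\theta_j}(x+iy)\mid x\ge0,\ |y|\le\alpha x^p\}.$$ If $G$ has a compact resolvent, then so has $T$.
   Context: Hilbert spaces are complex; operators are linear and possibly unbounded. $B_{r_0}(0)$ is the disc of radius $r_0$ around $0$ in $\mathbb{C}$. $S$ is $p$-subordinate to $G$ ($0\le p<1$) if $\mathcal{D}(G)\subset\mathcal{D}(S)$ and there is $b\ge0$ with $\|Su\|\le b\|u\|^{1-p}\|Gu\|^p$ for all $u\in\mathcal{D}(G)$; the minimal such $b$ is the $p$-subordination bound. Convention: $t^0=1$ for all $t\ge 0$ (when $p=0$). *)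

(* Defs.v *)
From HB Require Import structures.
From mathcomp Require Import all_boot all_order all_algebra.
From mathcomp Require Import complex.
From mathcomp Require Import all_classical all_reals all_analysis.

Set Implicit Arguments.
Unset Strict Implicit.
Unset Printing Implicit Defensive.

Import Order.TTheory GRing.Theory Num.Theory.
Import numFieldNormedType.Exports.

Local Open Scope classical_set_scope.
Local Open Scope ring_scope.
Local Open Scope complex_scope.

(* The inner product is linear in its first argument and conjugate linear in
   its second one. *)
HB.mixin Record NormedModule_isHilbert (R : realType) H
    & CompleteNormedModule R[i] H := {
  hdot : {dot H for (@Num.conj R[i])};
  hdot_norm : forall u : H, hdot u u = `|u| ^+ 2
}.

#[short(type="hilbertType")]
HB.structure Definition Hilbert (R : realType) :=
  {H of CompleteNormedModule R[i] H & NormedModule_isHilbert R H}.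

(* The norm of H takes its values in R[i]; [rnorm] is the same number in R. *)
Definition rnorm (R : realType) (H : hilbertType R) (u : H) : R :=
  complex.Re `|u|.

Lemma rnormE (R : realType) (H : hilbertType R) (u : H) :
  (rnorm u)%:C = `|u|.
Proof.
rewrite /rnorm; have := normr_ge0 u.
by case: (`|u|) => a c /=; rewrite lecE /= => /andP[/eqP ->].
Qed.

(* A possibly unbounded linear operator in H. Its values outside of [dom] are
   irrelevant: no definition below depends on them. *)
Record operator (R : realType) (H : hilbertType R) := Operator {
  dom : set H;
  app :> H -> H;
  dom0 : dom 0;
  dom_linear : forall (a : R[i]) u v, dom u -> dom v -> dom (a *: u + v);
  app_linear : forall (a : R[i]) u v, dom u -> dom v ->
    app (a *: u + v) = a *: app u + app v
}.

Section Operators.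
Variables (R : realType) (H : hilbertType R).
Implicit Types (A G S T : operator H) (p b : R).

Definition operator_eq A T :=
  dom A = dom T /\ forall u, dom A u -> A u = T u.

Lemma operator_map0 T : T 0 = 0.
Proof.
have := app_linear 1 (dom0 T) (dom0 T).
rewrite !scale1r addr0 => e.
by apply: (addrI (T 0)); rewrite addr0 -e.
Qed.

#[local] Obligation Tactic := idtac.

Program Definition operator_add A T : operator H :=
  @Operator R H (dom A `&` dom T) (fun u => A u + T u) _ _ _.
Next Obligation. by split; exact: dom0. Qed.
Next Obligation.
by move=> A T a u v [Au Tu] [Av Tv]; split; exact: dom_linear.
Qed.
Next Obligation.
by move=> A T a u v [Au Tu] [Av Tv]; rewrite !app_linear// scalerDr addrACA.
Qed.

Program Definition operator_comp A T : operator H :=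
  @Operator R H [set u | dom T u /\ dom A (T u)] (fun u => A (T u)) _ _ _.
Next Obligation. by move=> A T; split; rewrite ?operator_map0; exact: dom0. Qed.
Next Obligation.
move=> A T a u v [Tu ATu] [Tv ATv].
by split; [exact: dom_linear | rewrite app_linear//; exact: dom_linear].
Qed.
Next Obligation. by move=> A T a u v [Tu ATu] [Tv ATv]; rewrite !app_linear. Qed.

Definition densely_defined T := dense (dom T).

Definition closed_operator T :=
  closed [set x : H * H | dom T x.1 /\ x.2 = T x.1].

(* A is the adjoint of the densely defined operator T. *)
Definition is_adjoint T A := forall v w : H,
  (dom A v /\ A v = w) <-> (forall u, dom T u -> hdot (T u) v = hdot u w).

Definition normal_operator T :=
  [/\ densely_defined T, closed_operator T &
      exists A, is_adjoint T A /\
                operator_eq (operator_comp A T) (operator_comp T A)].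

(* B = (T - z)^-1, everywhere defined and bounded. *)
Definition is_resolvent T (z : R[i]) (B : {linear H -> H}) :=
  [/\ continuous B,
      forall v, dom T (B v) /\ T (B v) - z *: B v = v &
      forall u, dom T u -> B (T u - z *: u) = u].

Definition resolvent_set T : set R[i] := [set z | exists B, is_resolvent T z B].

Definition spectrum T : set R[i] := ~` resolvent_set T.

Definition compact_operator (B : {linear H -> H}) :=
  forall X : set H, bounded_set X -> precompact (B @` X).

(* By the resolvent identity, compactness for one z in the resolvent set gives
   compactness for all of them. *)
Definition compact_resolvent T :=
  exists z B, is_resolvent T z B /\ compact_operator B.

(* [powR] satisfies t `^ 0 = 1 for all t, including t = 0. *)
Definition subordination_constants p G S : set R :=
  [set b | 0 <= b /\
    forall u, dom G u -> rnorm (S u) <= b * rnorm u `^ (1 - p) * rnorm (G u) `^ p].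

Definition subordinate p G S :=
  dom G `<=` dom S /\ subordination_constants p G S !=set0.

Definition subordination_bound p G S b :=
  subordination_constants p G S b /\ lbound (subordination_constants p G S) b.

End Operators.

Section Regions.
Variable R : realType.

Definition expi (t : R) : R[i] := cos t +i* sin t.

Definition disc (r : R) : set R[i] := [set z | `|z| < r%:C].

Definition ray (t : R) : set R[i] :=
  [set z | exists x : R, 0 <= x /\ z = expi t * x%:C].

Definition parabola_region (t alpha p : R) : set R[i] :=
  [set z | exists x y : R,
    [/\ 0 <= x, `|y| <= alpha * x `^ p & z = expi t * (x +i* y)]].

End Regions.

(* Main.v *)
Require Import Defs.
From HB Require Import structures.
From mathcomp Require Import all_boot all_order all_algebra.
From mathcomp Require Import complex.
From mathcomp Require Import all_classical all_reals all_analysis.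
From mathcomp Require Import ring lra.

(** The resolvent of a normal operator [G] is controlled by the position of the
    spectrum alone. Let [0 < s <= 1]. If [s |z| <= |l - z|] and
    [s |l| <= |l - z|] for all [l] in the spectrum, then [B = (G - z)^-1] and
    [G B] have norms at most [1 / (s |z|)] and [1 / s]
    ([normal_resolvent_bounds]). Subordination turns this into
    [|S B| <= b / (s |z|^(1-p))]. When the right-hand side is smaller than 1,
    [1 + S B] is invertible, so that [z] is in the resolvent set of [T] and
    [(T - z)^-1 = B (1 + S B)^-1] ([subordinate_perturbation]).

    With respect to rays, [s] may be the sine of the smallest angle between [z]
    and a ray ([ray_distance]). For a [beta] strictly between [b] and [alpha]
    the value [s = beta / |z|^(1-p)] gives [|S B| <= b / beta < 1], and a point
    of large modulus that is outside all the parabolas makes this [s] admissible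
    with respect to all rays at once ([outside_parabola]). For the compactness
    statement one fixes a direction that is not on a ray and goes far out along
    it; there [(T - z)^-1 = B D] with [D] bounded, and compactness of the
    resolvent of [G] passes from one point to all others by the resolvent
    identity ([compact_resolvent_transfer]).

    The norm estimates (where a prime stands for adjoints and conjugates) are
    obtained without a spectral theorem, in two steps.

    - The resolvent is hyponormal, [|B' x| <= |B x|]
      ([normal_resolvent_hyponormal]). The adjoint [B'] exists by the Riesz
      theorem. The definition of normality only speaks of the domain of
      [G' G = G G'], where it gives [|(G' - z') u| = |(G - z) u|]. Since
      [B' B + (G B)' (G B)] is coercive, hence invertible, the vectors
      [(G - z) u] with [u] in that domain are dense, which is enough.

    - A hyponormal operator [N] satisfies [|N x|^2 <= |N N x| |x|], and every
      affine function of [N] does as well. Such an operator has an approximate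
      eigenvalue of modulus [|N|] ([paranormal_norm_le]), so its norm is at most
      [r] as soon as [N - c] is bounded below for every [c] with [r < |c|].
      After scaling to [|N| = 1], the powers of [N] almost preserve the length
      of a suitable [x]; some [w] with [|w| = 1] makes
      [y = \sum_(k < n) w^k N^k x] at least as long as if the summands were
      orthogonal, that is, of length about [sqrt n], whereas
      [y - w N y = x - w^n N^n x] has length at most 2. A cluster point of the
      numbers [w] as [n] grows is an approximate eigenvalue of modulus 1. *)

Set Implicit Arguments.
Unset Strict Implicit.
Unset Printing Implicit Defensive.

Import Order.TTheory GRing.Theory Num.Theory.
Import numFieldNormedType.Exports.

Local Open Scope classical_set_scope.
Local Open Scope ring_scope.
Local Open Scope complex_scope.

(** * Real-valued modulus, inner product and norm *)

Section Modulus.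
Variable R : realType.
Implicit Types a c : R[i].

Definition modc a : R := complex.Re `|a|.

Lemma modcE a : (modc a)%:C = `|a|.
Proof. by rewrite /modc RRe_real ?normr_real. Qed.

Lemma modc_ge0 a : 0 <= modc a.
Proof. by rewrite -lecR modcE normr_ge0. Qed.

Lemma modcM a c : modc (a * c) = modc a * modc c.
Proof. by apply: complexI; rewrite rmorphM/= !modcE normrM. Qed.

Lemma modcV a : modc a^-1 = (modc a)^-1.
Proof. by apply: complexI; rewrite fmorphV/= !modcE normfV. Qed.

Lemma modcN a : modc (- a) = modc a.
Proof. by rewrite /modc normrN. Qed.

Lemma modc1 : modc 1 = 1.
Proof. by rewrite /modc normr1. Qed.

Lemma modc_gt0 a : a != 0 -> 0 < modc a.
Proof. by move=> a0; rewrite -ltcR modcE normr_gt0. Qed.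

Lemma modcB a c : modc (a - c) = modc (c - a).
Proof. by rewrite /modc distrC. Qed.

Lemma modcD_le a c : modc (a + c) <= modc a + modc c.
Proof. by rewrite -lecR rmorphD/= !modcE ler_normD. Qed.

Lemma modc_real (t : R) : 0 <= t -> modc t%:C = t.
Proof.
by move=> t0; apply: complexI; rewrite modcE ger0_norm// ler0c.
Qed.

Lemma modc_conj a : modc (Num.conj a) = modc a.
Proof. by rewrite /modc norm_conjC. Qed.

Lemma sqr_modc a : modc a ^+ 2 = complex.Re a ^+ 2 + complex.Im a ^+ 2.
Proof. by apply: complexI; rewrite add_Re2_Im2 rmorphXn/= modcE. Qed.

Lemma modc_le_ReIm a : modc a <= `|complex.Re a| + `|complex.Im a|.
Proof.
rewrite -(@ler_pXn2r _ 2)// ?nnegrE ?modc_ge0 ?addr_ge0//.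
rewrite sqr_modc sqrrD !real_normK ?num_real// lerD2r lerDl.
by rewrite mulrn_wge0 ?mulr_ge0.
Qed.

End Modulus.

Section InnerProduct.
Variables (R : realType) (H : hilbertType R).
Implicit Types (u v w : H) (a : R[i]).

(** Over the reals, [H] is a Hilbert space for this inner product, with the same
    norm; inequalities between norms only involve this real part. *)
Definition rdot u v : R := complex.Re (hdot u v).

Lemma rdotDl u v w : rdot (u + v) w = rdot u w + rdot v w.
Proof. by rewrite /rdot linearDl raddfD. Qed.

Lemma rdotDr u v w : rdot u (v + w) = rdot u v + rdot u w.
Proof. by rewrite /rdot linearDr raddfD. Qed.

Lemma rdotNl u v : rdot (- u) v = - rdot u v.
Proof. by rewrite /rdot linearNl raddfN. Qed.

Lemma rdotNr u v : rdot u (- v) = - rdot u v.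
Proof. by rewrite /rdot linearNr raddfN. Qed.

Lemma hdotDl u v w : hdot (u + v) w = hdot u w + hdot v w.
Proof. by rewrite linearDl. Qed.

Lemma hdotDr u v w : hdot u (v + w) = hdot u v + hdot u w.
Proof. by rewrite linearDr. Qed.

Lemma hdotBl u v w : hdot (u - v) w = hdot u w - hdot v w.
Proof. by rewrite linearBl. Qed.

Lemma hdotBr u v w : hdot u (v - w) = hdot u v - hdot u w.
Proof. by rewrite linearBr. Qed.

Lemma hdotZl a u v : hdot (a *: u) v = a * hdot u v.
Proof. by rewrite linearZl_LR. Qed.

Lemma hdotZr a u v : hdot u (a *: v) = Num.conj a * hdot u v.
Proof. by rewrite linearZr_LR. Qed.

Lemma hdotC u v : hdot u v = Num.conj (hdot v u).
Proof. by rewrite hermC/= expr0 mul1r. Qed.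

Lemma rdotC u v : rdot u v = rdot v u.
Proof. by rewrite /rdot hdotC; case: (hdot v u). Qed.

Lemma rdotZl (t : R) u v : rdot (t%:C *: u) v = t * rdot u v.
Proof. by rewrite /rdot hdotZl; case: (hdot u v) => x y /=;
  rewrite mul0r subr0. Qed.

Lemma rdotZr (t : R) u v : rdot u (t%:C *: v) = t * rdot u v.
Proof. by rewrite rdotC rdotZl rdotC. Qed.

Lemma rnorm_sqr u : rnorm u ^+ 2 = rdot u u.
Proof.
apply: complexI; rewrite /rdot hdot_norm rmorphXn/= rnormE RRe_real//.
Qed.

Lemma rnorm_ge0 u : 0 <= rnorm u.
Proof. by rewrite -lecR rnormE normr_ge0. Qed.

Lemma rnorm0 : rnorm (0 : H) = 0.
Proof. by rewrite /rnorm normr0. Qed.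

Lemma rnorm_eq0 u : rnorm u = 0 -> u = 0.
Proof. by move=> u0; apply/eqP; rewrite -normr_eq0 -rnormE u0. Qed.

Lemma rnormN u : rnorm (- u) = rnorm u.
Proof. by rewrite /rnorm normrN. Qed.

Lemma rnormB u v : rnorm (u - v) = rnorm (v - u).
Proof. by rewrite /rnorm distrC. Qed.

Lemma rnormZ a u : rnorm (a *: u) = modc a * rnorm u.
Proof. by apply: complexI; rewrite rmorphM/= !rnormE modcE normrZ. Qed.

Lemma rnormD_le u v : rnorm (u + v) <= rnorm u + rnorm v.
Proof. by rewrite -lecR rmorphD/= !rnormE ler_normD. Qed.

Lemma rnorm_sqrD u v :
  rnorm (u + v) ^+ 2 = rnorm u ^+ 2 + 2 * rdot u v + rnorm v ^+ 2.
Proof. by rewrite !rnorm_sqr rdotDl !rdotDr (rdotC v u); ring. Qed.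

Lemma rnorm_sqrB u v :
  rnorm (u - v) ^+ 2 = rnorm u ^+ 2 - 2 * rdot u v + rnorm v ^+ 2.
Proof. by rewrite rnorm_sqrD rnormN rdotNr mulrN. Qed.

Lemma parallelogram u v :
  rnorm (u + v) ^+ 2 + rnorm (u - v) ^+ 2 =
  2 * (rnorm u ^+ 2 + rnorm v ^+ 2).
Proof. by rewrite rnorm_sqrD rnorm_sqrB; ring. Qed.

Lemma rdot_le u v : rdot u v <= rnorm u * rnorm v.
Proof.
have := rnorm_ge0 (u + v); have := rnorm_ge0 u; have := rnorm_ge0 v.
move=> v0 u0 uv0; have := rnormD_le u v.
rewrite -(@ler_pXn2r _ 2)// ?nnegrE ?addr_ge0// rnorm_sqrD.
nra.
Qed.

(** Real parts determine the complex inner product: multiply by [-i] to read off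
    the imaginary part. *)
Lemma hdot_eq u v w x : (forall a, rdot (a *: u) v = rdot (a *: w) x) ->
  hdot u v = hdot w x.
Proof.
move=> e; have := e (- 'i); have := e 1.
rewrite /rdot !hdotZl !mul1r.
by case: (hdot u v) => p q; case: (hdot w x) => r s /=; simpc => -> ->.
Qed.

End InnerProduct.

Section Sequences.
Variables (R : realType) (H : hilbertType R).

(** Balls of [H] have radii in [R[i]]; this restates completeness with real
    ones. *)
Lemma cauchy_limit (u : nat -> H) :
  (forall e : R, 0 < e -> exists N, forall m n, (N <= m)%N -> (N <= n)%N ->
     rnorm (u m - u n) < e) ->
  exists l, forall e : R, 0 < e -> exists N, forall n, (N <= n)%N ->
     rnorm (u n - l) < e.
Proof.
move=> cu.
have /cvg_ex[/= l ul] : cvgn u.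
  apply/cauchy_cvgP/cauchy_ballP => e; rewrite ltcE => /andP[/eqP ei er].
  have [N hN] := cu _ er.
  exists (u @` [set n | (N <= n)%N], u @` [set n | (N <= n)%N]) => /=.
    by split; exists N => // n Nn; exists n.
  move=> [_ _] /= [[m Nm <-] [n Nn <-]].
  rewrite -ball_normE /= -rnormE.
  have -> : e = (complex.Re e)%:C by case: (e) ei => x y /= ->.
  by rewrite ltcR hN.
exists l => e e0; move/cvgrPdist_lt : ul => /(_ e%:C); rewrite ltcR => /(_ e0).
move=> [N _ hN]; exists N => n /hN /=.
by rewrite -rnormE ltcR rnormB.
Qed.

Lemma continuous_linear_rnorm (f : {linear H -> H}) : continuous f <->
  exists2 M : R, 0 <= M & forall x, rnorm (f x) <= M * rnorm x.
Proof.
split.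
  move=> /linear_bounded_continuous /linear_boundedP /pinfty_ex_gt0[M M0 fM].
  exists (complex.Re M) => [|x].
    by move: M0; rewrite ltcE => /andP[_ /ltW].
  by rewrite -lecR rmorphM/= !rnormE RRe_real// gtr0_real.
move=> [M M0 fM]; apply/linear_bounded_continuous/bounded_funP => r.
exists (M%:C * r) => x xr; rewrite -rnormE.
rewrite (@le_trans _ _ (M%:C * `|x|))//.
  by rewrite -rnormE -rmorphM/= lecR.
by rewrite ler_wpM2l// ler0c.
Qed.

End Sequences.

(** * Orthogonal projection, Riesz representation, coercive operators *)

Section HilbertGeometry.
Variables (R : realType) (H : hilbertType R).
Implicit Types (u v w x : H) (a : R[i]) (V : set H).

Definition subspace V :=
  V 0 /\ forall a u v, V u -> V v -> V (a *: u + v).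

Lemma small_rnorm_eq x y : (forall e : R, 0 < e -> rnorm (x - y) <= e) -> x = y.
Proof.
move=> h; apply/eqP; rewrite -subr_eq0; apply/eqP/rnorm_eq0.
by apply/eqP; rewrite eq_le rnorm_ge0 andbT; apply/ler_addgt0Pr => e e0;
  rewrite add0r; exact: h.
Qed.

(** The limit [l] is the projection of [x] on the closure of [V]. A minimizing
    sequence [v] for the distance of [x] to [V] is Cauchy by the parallelogram
    law. *)
Lemma orthogonal_projection V x : subspace V ->
  exists v : nat -> H, exists l : H,
  [/\ forall n, V (v n),
      forall e : R, 0 < e -> exists N, forall n, (N <= n)%N -> rnorm (v n - l)
        < e &
      forall y, V y -> hdot y (x - l) = 0].
Proof.
move=> [V0 VL].
pose E := [set rnorm (x - v) ^+ 2 | v in V].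
have E0 : E !=set0 by exists (rnorm (x - 0) ^+ 2); exists 0.
have Elb : lbound E 0 by move=> _ [v _ <-]; exact: sqr_ge0.
have hE : has_inf E by split=> //; exists 0.
pose D := inf E.
have Dle v : V v -> D <= rnorm (x - v) ^+ 2.
  by move=> Vv; apply: ge_inf; [exists 0 | exists v].
have /choice[v hv] : forall n : nat, exists v,
    V v /\ rnorm (x - v) ^+ 2 < D + n.+1%:R^-1.
  move=> n; have e0 : 0 < n.+1%:R^-1 :> R by rewrite invr_gt0.
  by have [_ [v Vv <-] ?] := inf_adherent e0 hE; exists v.
have Vv n : V (v n) by have [] := hv n.
have vD n : rnorm (x - v n) ^+ 2 < D + n.+1%:R^-1 by have [] := hv n.
have small (e : R) : 0 < e -> exists N, forall n, (N <= n)%N -> n.+1%:R^-1 < e.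
  move=> e0; have [N _ hN] := near_infty_natSinv_lt (PosNum e0).
  by exists N => n /hN.
have [|l vl] := @cauchy_limit _ _ v.
  move=> e e0; have [|N hN] := small (e ^+ 2 / 4); first by nra.
  exists N => m n /hN mN /hN nN.
  rewrite -(@ltr_pXn2r _ 2)// ?nnegrE ?rnorm_ge0 ?ltW//.
  have := parallelogram (x - v m) (x - v n).
  have -> : x - v m + (x - v n) = 2%:C *: (x - 2^-1%:C *: (v m + v n)).
    rewrite scalerBr scalerA -rmorphM/= divff ?pnatr_eq0// rmorph1 scale1r.
    rewrite addrACA -opprD; congr (_ - _).
    by rewrite -[2%:C]/((1 + 1)%:C) rmorphD scalerDl rmorph1 !scale1r.
  have -> : x - v m - (x - v n) = v n - v m.
    by rewrite opprB addrC addrA subrK.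
  rewrite rnormZ modc_real// exprMn => pl.
  have := Dle (2^-1%:C *: (v m + v n)).
  have Vh : V (2^-1%:C *: (v m + v n)).
    rewrite scalerDr -[X in _ + X]addr0.
    exact/(VL _ _ _ (Vv m))/(VL _ _ _ (Vv n) V0).
  move=> /(_ Vh); rewrite (rnormB (v m)); have := vD m; have := vD n.
  move: (n.+1%:R^-1) nN (m.+1%:R^-1) mN => p pe q qe; nra.
exists v, l; split=> //.
suff ort y : V y -> rdot y (x - l) <= 0.
  move=> y Vy; transitivity (hdot 0 (x - l)); last by rewrite linear0l.
  apply: hdot_eq => a; rewrite scaler0 /rdot linear0l/=.
  have VZ c : V (c *: y) by rewrite -[_ *: _]addr0; exact: VL.
  apply/eqP; rewrite eq_le ort//= -oppr_le0 -[X in X <= _]rdotNl -scaleNr.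
  exact: ort.
move=> Vy; set r := rdot _ _; set q := rnorm y ^+ 2.
(* compare [x - v n] with [x - v n - t y] and let [n] grow *)
have key t : 0 <= t -> 2 * t * r <= t ^+ 2 * q.
  move=> t0; apply/ler_addgt0Pr => e e0.
  have [|N1 h1] := small (e / 2); first by lra.
  have y0 := rnorm_ge0 y.
  have [|N2 h2] := vl (e / (4 * (t * rnorm y + 1))).
    by rewrite divr_gt0// mulr_gt0// ltr_wpDl// mulr_ge0.
  have {h1}h1 := h1 (maxn N1 N2) (leq_maxl _ _).
  have {h2}h2 := h2 (maxn N1 N2) (leq_maxr _ _).
  move: h1 h2; set n := maxn N1 N2 => h1 h2.
  have Vw : V (v n + t%:C *: y) by rewrite addrC; exact: VL.
  have := Dle _ Vw; rewrite opprD addrA rnorm_sqrB rnormZ modc_real// exprMn.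
  rewrite rdotZr => hD.
  have e1 : r = rdot (x - v n) y + rdot (v n - l) y.
    by rewrite -rdotDl addrA subrK rdotC.
  have h3 := rdot_le (v n - l) y.
  have h4 : 4 * (t * rnorm y) * rnorm (v n - l) <= e.
    have := h2; rewrite ltr_pdivlMr;
      last by rewrite mulr_gt0// ltr_wpDl// mulr_ge0.
    have := rnorm_ge0 (v n - l); nra.
  have := vD n; rewrite -/q in hD *; rewrite e1.
  move: (n.+1%:R^-1) h1 => d dh; nra.
have q0 : 0 <= q by exact: sqr_ge0.
rewrite leNgt; apply/negP => r0.
have := key (r / (q + 1)) (divr_ge0 (ltW r0) (addr_ge0 q0 ler01)).
have q1 : 0 < q + 1 by lra.
have -> : 2 * (r / (q + 1)) * r = 2 * r ^+ 2 * (q + 1) / (q + 1) ^+ 2.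
  by field; rewrite gt_eqF.
have -> : (r / (q + 1)) ^+ 2 * q = r ^+ 2 * q / (q + 1) ^+ 2.
  by field; rewrite gt_eqF.
rewrite ler_pM2r ?invr_gt0 ?exprn_gt0//.
have := exprn_gt0 2 r0; move: (r ^+ 2) => s s0; nra.
Qed.

Lemma orthocomplement0_dense V : subspace V ->
  (forall x, (forall y, V y -> hdot y x = 0) -> x = 0) ->
  forall x (e : R), 0 < e -> exists2 v, V v & rnorm (x - v) < e.
Proof.
move=> sV V0 x e e0; have [v [l [Vv vl ort]]] := orthogonal_projection x sV.
have /eqP := V0 _ ort; rewrite subr_eq0 => /eqP ->.
by have [N /(_ N (leqnn N)) h] := vl e e0; exists (v N) => //; rewrite rnormB.
Qed.

Lemma hdot_ext x y : (forall u, hdot u x = hdot u y) -> x = y.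
Proof.
move=> h; apply/eqP; rewrite -subr_eq0; apply/eqP/rnorm_eq0/eqP.
by rewrite -sqrf_eq0 rnorm_sqr /rdot hdotBr h subrr.
Qed.

Lemma modc_hdot_le u v : modc (hdot u v) <= rnorm u * rnorm v.
Proof.
have [->|d0] := eqVneq (hdot u v) 0.
  by rewrite /modc normr0 mulr_ge0 ?rnorm_ge0.
pose a := `|hdot u v| / hdot u v.
have a1 : modc a = 1.
  by apply: complexI; rewrite modcE normf_div normr_id divff// normr_eq0.
(* [a] rotates the inner product onto the positive axis *)
have -> : modc (hdot u v) = rdot (a *: u) v.
  by rewrite /rdot hdotZl divfK.
by rewrite (le_trans (rdot_le _ _))// rnormZ a1 mul1r.
Qed.

(** The representing vector is a multiple of the component of [e], where
    [f e <> 0], that is orthogonal to the kernel of [f]. *)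
Lemma riesz (f : H -> R[i]) (M : R) :
  (forall a u v, f (a *: u + v) = a * f u + f v) ->
  (forall u, modc (f u) <= M * rnorm u) ->
  exists w, forall u, f u = hdot u w.
Proof.
move=> fL fM.
have f0 : f 0 = 0.
  have := fL 1 0 0; rewrite scale1r addr0 mul1r => e.
  by apply: (addrI (f 0)); rewrite addr0 -e.
have [[e fe]|] := pselect (exists e, f e <> 0); last first.
  move=> nf; exists 0 => u; rewrite linear0r.
  by apply: contrapT => fu; apply: nf; exists u.
pose V := [set u | f u = 0].
have sV : subspace V.
  by split=> //= a u v; rewrite /V/= fL => -> ->; rewrite mulr0 addr0.
have [v [l [Vv vl ort]]] := orthogonal_projection e sV.
have fN u w : f (u - w) = f u - f w.
  by rewrite addrC -scaleN1r fL mulN1r addrC.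
have fl : f l = 0.
  apply/eqP; rewrite -normr_eq0 -modcE; apply/eqP; congr (_%:C).
  apply/eqP; rewrite eq_le modc_ge0 andbT; apply/ler_addgt0Pr => d d0;
    rewrite add0r.
  have [N /(_ N (leqnn N)) h] := vl (d / (`|M| + 1)) (divr_gt0 d0 (ltr_wpDl
    (normr_ge0 _) ltr01)).
  have := fM (l - v N); rewrite fN Vv subr0 rnormB.
  move: h; rewrite ltr_pdivlMr ?ltr_wpDl//.
  have := rnorm_ge0 (v N - l); have := ler_norm M; nra.
pose w := e - l.
have fw : f w = f e by rewrite fN fl subr0.
have w0 : hdot w w != 0.
  apply/eqP => w0; apply: fe; rewrite -fw.
  suff -> : w = 0 by [].
  by apply/rnorm_eq0/eqP; rewrite -sqrf_eq0 rnorm_sqr /rdot w0.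
exists (Num.conj (f e / hdot w w) *: w) => u.
rewrite hdotZr conjCK.
have : hdot (u - (f u / f e) *: w) w = 0.
  apply: ort; rewrite /V/= fN -[_ *: w]addr0 fL f0 addr0 fw divfK ?subrr//.
  exact/eqP.
rewrite hdotBl hdotZl => /eqP; rewrite subr_eq0 => /eqP ->.
by field; rewrite w0; apply/andP; split=> //; apply/eqP.
Qed.

(** Packs functions obtained by choice or by a formula, for which the linear
    structure cannot be inferred. *)
Lemma linear_of (f : H -> H) : linear f -> exists F : {linear H -> H}, F =1 f.
Proof.
move=> fL; pose F : {linear H -> H} := HB.pack f (GRing.isLinear.Build _ _ _ _
  f fL).
by exists F.
Qed.

Lemma bounded_adjoint (B : {linear H -> H}) (M : R) : 0 <= M ->
  (forall x, rnorm (B x) <= M * rnorm x) ->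
  exists B' : {linear H -> H}, (forall u v, hdot (B u) v = hdot u (B' v)) /\
    (forall x, rnorm (B' x) <= M * rnorm x).
Proof.
move=> M0 BM.
have /choice[f hf] : forall v, exists w, forall u, hdot (B u) v = hdot u w.
  move=> v; apply: (@riesz (fun u => hdot (B u) v) (M * rnorm v)).
    by move=> a u w; rewrite linearP hdotDl hdotZl.
  move=> u; rewrite (le_trans (modc_hdot_le _ _))// mulrAC ler_wpM2r//.
  exact: rnorm_ge0.
have [|B' eB] := @linear_of f.
  move=> a u v; apply: hdot_ext => x.
  by rewrite -hf hdotDr hdotZr hdotDr hdotZr !hf.
exists B'; split=> [u v|x]; first by rewrite eB hf.
rewrite eB; have := rnorm_ge0 (f x); rewrite le_eqVlt => /predU1P[<-|x0].
  by rewrite mulr_ge0 ?rnorm_ge0.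
rewrite -(ler_pM2r x0) -expr2 rnorm_sqr /rdot -hf -/(rdot _ _).
rewrite (le_trans (rdot_le _ _))// mulrAC ler_wpM2r ?rnorm_ge0//.
Qed.

(** Lax-Milgram: coercivity bounds [P] below, so that its range is closed, and
    nothing nonzero is orthogonal to the range. It is applied to
    [B' B + (G B)' (G B)] and to [1 + S B]. *)
Lemma coercive_inverse (P : {linear H -> H}) (m M : R) : 0 < m ->
  (forall x, rnorm (P x) <= M * rnorm x) ->
  (forall x, m * rnorm x ^+ 2 <= rdot (P x) x) ->
  exists D : {linear H -> H}, [/\ cancel D P, cancel P D &
    forall x, rnorm (D x) <= m^-1 * rnorm x].
Proof.
move=> m0 PM Pm.
have lb x : m * rnorm x <= rnorm (P x).
  have := rnorm_ge0 x; rewrite le_eqVlt => /predU1P[<-|x0].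
    by rewrite mulr0 rnorm_ge0.
  by rewrite -(ler_pM2r x0) -mulrA -expr2 (le_trans (Pm x))// rdot_le.
have sV : subspace (range P).
  split; first by exists 0; rewrite ?linear0.
  by move=> a _ _ [u _ <-] [v _ <-]; exists (a *: u + v); rewrite ?linearP.
have onto x : exists h, P h = x.
  have [v [l [Vv vl ort]]] := orthogonal_projection x sV.
  have /choice[h hv] : forall n, exists h, P h = v n.
    by move=> n; have [h _ <-] := Vv n; exists h.
  have [|k hk] := @cauchy_limit _ _ h.
    move=> e e0; have [|N hN] := vl (m * e / 2); first by nra.
    exists N => p q /hN pN /hN qN; rewrite -(ltr_pM2l m0).
    rewrite (le_lt_trans (lb _))// linearB !hv.
    rewrite (_ : v p - v q = (v p - l) + (l - v q));
      last by rewrite addrA subrK.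
    rewrite (le_lt_trans (rnormD_le _ _))// (rnormB l); lra.
  have Pk : P k = l.
    apply: small_rnorm_eq => e e0.
    have [|N1 h1] := vl (e / 2); first by lra.
    have [|N2 h2] := hk (e / (2 * (`|M| + 1))).
      by rewrite divr_gt0// mulr_gt0// ltr_wpDl.
    have {}h1 := h1 (maxn N1 N2) (leq_maxl _ _).
    have {}h2 := h2 (maxn N1 N2) (leq_maxr _ _).
    rewrite (_ : P k - l = P (k - h (maxn N1 N2)) + (v (maxn N1 N2) - l));
      last first.
      by rewrite linearB/= hv addrA subrK.
    rewrite (le_trans (rnormD_le _ _))//.
    have := PM (k - h (maxn N1 N2)); rewrite (rnormB k).
    move: h2; rewrite ltr_pdivlMr; last by rewrite mulr_gt0// ltr_wpDl.
    have := ler_norm M; have := rnorm_ge0 (h (maxn N1 N2) - k).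
    move: (rnorm (h _ - k)) => d d0 hM hd hP.
    have := ler_wpM2r d0 hM; nra.
  exists k; rewrite Pk; apply/eqP; rewrite eq_sym -subr_eq0;
    apply/eqP/rnorm_eq0.
  have := Pm (x - l); rewrite /rdot ort/=; last by exists (x - l).
  by rewrite pmulr_rle0// => h0; apply/eqP; rewrite -sqrf_eq0 eq_le h0 sqr_ge0.
have inj : injective P.
  move=> x y e; apply/eqP; rewrite -subr_eq0; apply/eqP/rnorm_eq0.
  have := lb (x - y); rewrite linearB e subrr rnorm0 pmulr_rle0// => h0.
  by apply/eqP; rewrite eq_le h0 rnorm_ge0.
have [d hd] := choice onto.
have [|D eD] := @linear_of d.
  by move=> a u v; apply: inj; rewrite linearP/= !hd.
exists D; split=> [x|x|x]; first by rewrite eD hd.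
  by apply: inj; rewrite eD hd.
by rewrite ler_pdivlMl// (le_trans (lb _))// eD hd.
Qed.

End HilbertGeometry.

(** * Approximate eigenvalues of maximal modulus *)

(** Bolzano-Weierstrass in the complex plane, from compactness of a square in
    [R * R]. *)
Lemma modc_bounded_cluster (R : realType) (w : nat -> R[i]) :
  (forall n, modc (w n) <= 1) ->
  exists c, forall (e : R) (N : nat), 0 < e ->
    exists2 n, (N <= n)%N & modc (w n - c) < e.
Proof.
move=> w1.
pose f n : R * R := (complex.Re (w n), complex.Im (w n)).
pose I := `[-1, 1]%classic : set R.
have cI : compact (I `*` I) by apply: compact_setX; exact: segment_compact.
have It t : t ^+ 2 <= 1 -> I t.
  by move=> ?; rewrite /I /= in_itv/=; apply/andP; split; nra.
have fI n : (I `*` I) (f n).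
  have := w1 n; rewrite -(@ler_pXn2r _ 2)// ?nnegrE ?modc_ge0// sqr_modc expr1n.
  by move=> h; split; apply: It => /=; nra.
have [|[x y] [_ cl]] := cI (f @ \oo) _.
  by exists 0 => // n _; exact: fI.
exists (x +i* y) => e N e0.
have e2 : 0 < e / 2 by lra.
have F1 : (f @ \oo) (f @` [set n | (N <= n)%N]) by exists N => // n Nn;
  exists n.
have F2 : nbhs (x, y) (ball x (e / 2) `*` ball y (e / 2)).
  by exists (ball x (e / 2), ball y (e / 2)) => //; split; exact: nbhsx_ballx.
have [p [[n Nn <-] [/= h1 h2]]] := cl _ _ F1 F2.
exists n => //; rewrite (le_lt_trans (modc_le_ReIm _))//.
case: (w n) h1 h2 => a b /=; rewrite /ball/= => h1 h2.
by rewrite (distrC a) (distrC b); lra.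
Qed.

Section ApproximateEigenvalue.
Variables (R : realType) (H : hilbertType R).
Implicit Types (x y : H).

Lemma sum_double (V : zmodType) (f : nat -> V) n :
  \sum_(0 <= k < n.*2) f k = \sum_(0 <= k < n) (f k.*2 + f k.*2.+1).
Proof.
elim: n => [|n IH]; first by rewrite !big_nil.
by rewrite doubleS !big_nat_recr//= IH addrA.
Qed.

(** On average over the [2 ^ m]-th roots of unity the powers of [w] make the
    summands orthogonal; the inequality holds where the right-hand side is at
    least its average. The induction splits a sum into its even and odd parts,
    [E + w O] with [E] and [O] depending on [w ^ 2] only, and chooses between
    [w] and [- w] by the parallelogram law. As the same [w] has to serve both
    parts at the next stage, the statement is about families of sequences. *)
Lemma unimodular_sum m (s : seq (nat -> H)) : exists2 w : R[i], modc w = 1 &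
  \sum_(a <- s) \sum_(0 <= k < 2 ^ m) rnorm (a k) ^+ 2 <=
  \sum_(a <- s) rnorm (\sum_(0 <= k < 2 ^ m) w ^+ k *: a k) ^+ 2.
Proof.
elim: m s => [|m IH] s.
  exists 1; first exact: modc1.
  by apply: ler_sum => a _; rewrite expn0 !big_nat1 expr0 scale1r.
have [v v1] := IH ([seq a \o double | a : nat -> H <- s] ++
  [seq a \o S \o double | a : nat -> H <- s]).
rewrite !big_cat !big_map/= -!big_split/=.
pose E (a : nat -> H) := \sum_(0 <= k < 2 ^ m) v ^+ k *: a k.*2.
pose O (a : nat -> H) := \sum_(0 <= k < 2 ^ m) v ^+ k *: a k.*2.+1.
under eq_bigr => a _ do rewrite -big_split/=.
rewrite -/E -/O => le.
have split_sum w (a : nat -> H) : w ^+ 2 = v ->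
    \sum_(0 <= k < 2 ^ m.+1) w ^+ k *: a k = E a + w *: O a.
  move=> wv; rewrite expnS mul2n sum_double big_split/= scaler_sumr.
  congr (_ + _); apply: eq_bigr => k _; rewrite -muln2 mulnC.
    by rewrite exprM wv.
  by rewrite exprS exprM wv scalerA.
pose w := sqrtC v.
have w2 : w ^+ 2 = v by rewrite sqrtCK.
have w1 : modc w = 1.
  apply/eqP; rewrite -(@eqrXn2 _ 2)// ?modc_ge0// expr1n expr2 -modcM -expr2 w2.
  exact/eqP.
have sums : \sum_(a <- s) rnorm (E a + w *: O a) ^+ 2 +
    \sum_(a <- s) rnorm (E a - w *: O a) ^+ 2 =
    2 * \sum_(a <- s) (rnorm (E a) ^+ 2 + rnorm (O a) ^+ 2).
  rewrite -big_split/= mulr_sumr; apply: eq_bigr => a _.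
  by rewrite parallelogram rnormZ w1 mul1r.
have -> : \sum_(a <- s) \sum_(0 <= k < 2 ^ m.+1) rnorm (a k) ^+ 2 =
    \sum_(a <- s) \sum_(0 <= k < 2 ^ m)
      (rnorm (a k.*2) ^+ 2 + rnorm (a k.*2.+1) ^+ 2).
  by apply: eq_bigr => a _; rewrite expnS mul2n sum_double.
have [h|h] := leP (\sum_(a <- s) rnorm (E a - w *: O a) ^+ 2)
    (\sum_(a <- s) rnorm (E a + w *: O a) ^+ 2).
  exists w => //; under [X in _ <= X]eq_bigr => a _ do rewrite (split_sum w)//.
  by rewrite (le_trans le)//; lra.
exists (- w); first by rewrite modcN.
under [X in _ <= X]eq_bigr => a _ do rewrite (split_sum (- w)) ?sqrrN// scaleNr.
by rewrite (le_trans le)//; lra.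
Qed.

(** The hypothesis on [K] says that the ratios [|K^(k+1) x| / |K^k x|] do not
    decrease with [k]. *)
Lemma paranormal_growth (K : H -> H) (c : R) x :
  (forall x, rnorm (K x) ^+ 2 <= rnorm (K (K x)) * rnorm x) -> K 0 = 0 ->
  0 <= c -> c * rnorm x <= rnorm (K x) ->
  forall k, c ^+ k * rnorm x <= rnorm (iter k K x).
Proof.
move=> pK K0 c0 cx.
have step k : c * rnorm (iter k K x) <= rnorm (iter k.+1 K x).
  elim: k => //= k; set y := iter k K x => IH.
  have [/rnorm_eq0 ->|y0] := eqVneq (rnorm y) 0;
    first by rewrite !K0 rnorm0 mulr0.
  have {}y0 : 0 < rnorm y by rewrite lt_def y0 rnorm_ge0.
  rewrite -(ler_pM2r y0) (le_trans _ (pK y))//.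
  have := rnorm_ge0 (K y); nra.
elim=> [|k IH]; first by rewrite expr0 mul1r.
rewrite exprS -mulrA (le_trans _ (step k))// ler_wpM2l//.
Qed.

Lemma bernoulli_pow (t : R) n : 0 <= t <= 1 -> 1 - n%:R * t <= (1 - t) ^+ n.
Proof.
move=> t01; elim: n => [|n IH]; first by rewrite mul0r subr0.
rewrite exprS -natr1; have : 0 <= n%:R :> R by []; move: (n%:R) IH => p.
by move: ((1 - t) ^+ n) => q; nra.
Qed.

(** Here [y = \sum_(k < n) w^k K^k x], with [n = 2 ^ m] and [x] so close to norm
    attaining that its first [n] iterates keep at least half of its length. The
    difference [y - w K y] telescopes to two terms. *)
Lemma near_unimodular_eigenvector (K : {linear H -> H}) :
  (forall x, rnorm (K x) <= rnorm x) ->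
  (forall x, rnorm (K x) ^+ 2 <= rnorm (K (K x)) * rnorm x) ->
  (forall c : R, c < 1 -> exists x, c * rnorm x < rnorm (K x)) ->
  forall m, exists w : R[i], modc w = 1 /\ exists y, 0 < rnorm y /\
    (2 ^ m)%:R * rnorm (y - w *: K y) ^+ 2 <= 16 * rnorm y ^+ 2.
Proof.
move=> K1 pK Ksup m; set n := (2 ^ m)%N.
have n0 : 0 < n%:R :> R by rewrite ltr0n expn_gt0.
pose t : R := (2 * n%:R)^-1.
have t0 : 0 < t by rewrite invr_gt0 mulr_gt0.
have tn : n%:R * t = 2^-1 by rewrite /t invfM mulrCA divff ?mulr1// gt_eqF.
have t1 : t <= 1 / 2.
  have : 1 <= n%:R :> R by rewrite ler1n expn_gt0.
  nra.
have [|x hx] := Ksup (1 - t); first by lra.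
have x0 : 0 < rnorm x.
  have := rnorm_ge0 x; rewrite le_eqVlt => /predU1P[x0|//].
  by have := K1 x; have := rnorm_ge0 (K x); nra.
have lo k : (k < n)%N -> rnorm x / 2 <= rnorm (iter k K x).
  move=> kn; have c0 : 0 <= 1 - t by lra.
  apply: le_trans (paranormal_growth pK (linear0 K) c0 (ltW hx) k).
  rewrite mulrC ler_pM2r//.
  apply: le_trans (bernoulli_pow k (_ : 0 <= t <= 1)); last by apply/andP;
    split; lra.
  have : k%:R <= n%:R :> R by rewrite ler_nat ltnW.
  move: (k%:R) => p; nra.
have hi k : rnorm (iter k K x) <= rnorm x.
  by elim: k => //= k IH; rewrite (le_trans (K1 _)).
have [w w1] := unimodular_sum m [:: fun k => iter k K x].
rewrite !big_seq1 -/n; set y := \sum_(0 <= k < n) w ^+ k *: _ => hy.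
have wk k : modc (w ^+ k) = 1.
  by elim: k => [|k IH]; rewrite ?expr0 ?modc1// exprS modcM w1 IH mul1r.
have telescope k : let z := \sum_(0 <= i < k) w ^+ i *: iter i K x in
    z - w *: K z = x - w ^+ k *: iter k K x.
  elim: k => [|k IH] /=.
    by rewrite big_nil linear0 scaler0 subr0 expr0 scale1r subrr.
  rewrite big_nat_recr//= linearD/= scalerDr opprD addrACA IH [K (_ *:
    _)]linearZ/=.
  by rewrite scalerA -exprS addrA subrK.
have yx : n%:R * (rnorm x / 2) ^+ 2 <= rnorm y ^+ 2.
  apply: le_trans hy; rewrite mulr_natl -[X in _ *+ X]subn0 -sumr_const_nat.
  apply: ler_sum_nat => k /andP[_ kn].
  by rewrite ler_pXn2r ?nnegrE ?rnorm_ge0 ?divr_ge0 ?rnorm_ge0// lo.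
have dy : rnorm (y - w *: K y) <= 2 * rnorm x.
  rewrite telescope (le_trans (rnormD_le _ _))// rnormN rnormZ wk mul1r.
  by have := hi n; lra.
have d2 : rnorm (y - w *: K y) ^+ 2 <= 4 * rnorm x ^+ 2.
  by have := rnorm_ge0 (y - w *: K y); nra.
exists w; split => //; exists y; split.
  rewrite lt_def rnorm_ge0 andbT; apply: contraTneq yx => ->.
  rewrite expr0n/= -ltNge mulr_gt0// exprn_gt0// divr_gt0//.
move: (rnorm y ^+ 2) yx (rnorm _ ^+ 2) d2 => q qx d dx.
have := ler_wpM2l (ltW n0) dx; rewrite mulrCA; nra.
Qed.

Lemma unimodular_approximate_eigenvalue (K : {linear H -> H}) :
  (forall x, rnorm (K x) <= rnorm x) ->
  (forall x, rnorm (K x) ^+ 2 <= rnorm (K (K x)) * rnorm x) ->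
  (forall c : R, c < 1 -> exists x, c * rnorm x < rnorm (K x)) ->
  exists2 w : R[i], modc w = 1 & forall e : R, 0 < e ->
    exists2 y, 0 < rnorm y & rnorm (y - w *: K y) <= e * rnorm y.
Proof.
move=> K1 pK Ksup.
have /choice[f hf] := near_unimodular_eigenvector K1 pK Ksup.
have f1 n : modc (f n) = 1 by have [] := hf n.
have [|c hc] := @modc_bounded_cluster _ f; first by move=> n; rewrite f1.
have c1 : modc c = 1.
  apply/eqP; rewrite eq_le; apply/andP; split; apply/ler_addgt0Pr => e e0.
    have [n _ h] := hc e 0%N e0; have := modcD_le (c - f n) (f n).
    by rewrite subrK f1 modcB; lra.
  have [n _ h] := hc e 0%N e0; have := modcD_le (f n - c) c.
  by rewrite subrK f1; lra.
exists c => // e e0.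
(* [2 ^ n] has to exceed [64 / e ^ 2], and [2 ^ n > n] *)
have e4 : 0 < (e / 8) ^+ 2 by rewrite exprn_gt0// divr_gt0.
have [N _ hN] := near_infty_natSinv_lt (PosNum e4).
have [|n Nn fc] := hc (e / 2) N; first by lra.
have [_ [y [y0 hy]]] := hf n; exists y => //.
have big : 4 ^+ 2 <= (2 ^ n)%:R * (e / 2) ^+ 2.
  have := hN n Nn => /=; rewrite invf_plt ?posrE// => h.
  have : n.+1%:R <= (2 ^ n)%:R :> R by rewrite ler_nat ltn_expl.
  move/(lt_le_trans h); rewrite -(@ltr_pM2r _ ((e / 8) ^+ 2))// mulVf ?gt_eqF//.
  rewrite (_ : (e / 2) ^+ 2 = 16 * (e / 8) ^+ 2); last by field.
  by move: ((e / 8) ^+ 2) (_%:R) => p q; nra.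
have small : rnorm (y - f n *: K y) <= e / 2 * rnorm y.
  rewrite -(@ler_pXn2r _ 2)// ?nnegrE ?mulr_ge0 ?rnorm_ge0//; last by lra.
  have p2 : 0 < (2 ^ n)%:R :> R by rewrite ltr0n expn_gt0.
  rewrite -(ler_pM2l p2) (le_trans hy)//.
  by have := ler_wpM2r (sqr_ge0 (rnorm y)) big; rewrite exprMn; nra.
have -> : y - c *: K y = (y - f n *: K y) + (f n - c) *: K y.
  by rewrite scalerBl addrA subrK.
rewrite (le_trans (rnormD_le _ _))// rnormZ.
have := K1 y; have := rnorm_ge0 (K y); have := modc_ge0 (f n - c); nra.
Qed.

(** With [L] the norm of [N], an approximate eigenvalue of modulus 1 of [N / L]
    makes [N - c] not bounded below for some [c] with [|c| = L]; so [L <= r]. *)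
Lemma paranormal_norm_le (N : {linear H -> H}) (M r : R) :
  (forall x, rnorm (N x) <= M * rnorm x) ->
  (forall x, rnorm (N x) ^+ 2 <= rnorm (N (N x)) * rnorm x) ->
  0 < r ->
  (forall c : R[i], r < modc c -> exists2 d : R, 0 < d &
     forall y, d * rnorm y <= rnorm (N y - c *: y)) ->
  forall x, rnorm (N x) <= r * rnorm x.
Proof.
move=> NM pN r0 below.
pose E := [set L : R | 0 <= L /\ exists2 x, 0 < rnorm x & L * rnorm x <= rnorm
  (N x)].
have EM L : E L -> L <= M.
  move=> [_ [x x0 Lx]]; rewrite -(ler_pM2r x0); exact: le_trans (NM x).
apply: contrapT => /existsNP[x0 /negP]; rewrite -ltNge => hx0.
have x00 : 0 < rnorm x0.
  rewrite lt_def rnorm_ge0 andbT; apply: contraTneq hx0 => /rnorm_eq0 ->.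
  by rewrite linear0 rnorm0 mulr0 ltxx.
have Ex0 : E (rnorm (N x0) / rnorm x0).
  split; first by rewrite divr_ge0 ?rnorm_ge0.
  by exists x0 => //; rewrite divfK// gt_eqF.
have supE : has_sup E by split; [exists (rnorm (N x0) / rnorm x0) | exists M].
pose L := sup E.
have rL : r < L.
  rewrite (lt_le_trans (_ : r < rnorm (N x0) / rnorm x0))//.
    by rewrite ltr_pdivlMr.
  by apply: ub_le_sup => //; exact: supE.2.
have L0 : 0 < L by lra.
have NL x : rnorm (N x) <= L * rnorm x.
  have := rnorm_ge0 x; rewrite le_eqVlt => /predU1P[/esym/rnorm_eq0 ->|xp].
    by rewrite linear0 rnorm0 mulr0.
  rewrite -ler_pdivrMr//; apply: ub_le_sup; first exact: supE.2.
  split; first by rewrite divr_ge0 ?rnorm_ge0.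
  by exists x => //; rewrite divfK// gt_eqF.
have [|K eK] := @linear_of _ _ (fun x => L^-1%:C *: N x).
  by move=> a x y; rewrite linearP/= scalerDr !scalerA mulrC.
have nK x : rnorm (K x) = rnorm (N x) / L.
  by rewrite eK rnormZ modc_real ?invr_ge0 ?(ltW L0)// mulrC.
have [x|x|c c1|w w1 hw] := @unimodular_approximate_eigenvalue K.
- by rewrite nK ler_pdivrMr// mulrC.
- rewrite !nK eK linearZ/= rnormZ modc_real ?invr_ge0 ?(ltW L0)//.
  rewrite (_ : _ / _ * _ = rnorm (N (N x)) * rnorm x / L ^+ 2).
    by rewrite expr_div_n ler_pM2r ?invr_gt0 ?exprn_gt0.
  by field; rewrite gt_eqF.
- have [|l [l0 [x xp lx]] cl] := @sup_adherent _ E ((1 - c) * L) _ supE;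
    first by nra.
  exists x; rewrite nK ltr_pdivlMr//; apply: lt_le_trans lx.
  by rewrite mulrAC ltr_pM2r//; move: cl; rewrite -/L; nra.
have w0 : w != 0 by apply: contra_eq_neq w1 => ->;
  rewrite /modc normr0 eq_sym oner_eq0.
have [|d d0 hd] := below (L%:C / w).
  by rewrite modcM modcV w1 invr1 mulr1 modc_real// ltW.
have [|y y0] := hw (d / (2 * L)); first by rewrite divr_gt0// mulr_gt0.
have -> : y - w *: K y = - (w / L%:C) *: (N y - (L%:C / w) *: y).
  rewrite eK scalerBr !scaleNr opprK !scalerA addrC fmorphV.
  suff -> : w / L%:C * (L%:C / w) = 1 by rewrite scale1r.
  by field; rewrite w0 eq_complex/= gt_eqF.
rewrite rnormZ modcN modcM w1 mul1r modcV modc_real ?(ltW L0)//.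
rewrite -(ler_pM2l L0) mulrA mulfV ?gt_eqF// mul1r => h.
have := le_trans (hd y) h.
rewrite (_ : L * _ = d / 2 * rnorm y); last by field; rewrite gt_eqF.
rewrite ler_pM2r//; lra.
Qed.

End ApproximateEigenvalue.

(** * Hyponormality of the resolvent of a normal operator *)

Section Hyponormal.
Variables (R : realType) (H : hilbertType R).

Lemma affine_of (N : {linear H -> H}) (a c : R[i]) :
  exists K : {linear H -> H}, forall x, K x = a *: x + c *: N x.
Proof.
have [|K eK] := @linear_of _ _ (fun x => a *: x + c *: N x).
  move=> t x y; rewrite linearP !scalerDr !scalerA addrACA.
  by rewrite (mulrC a) (mulrC c).
by exists K.
Qed.

(** Hyponormality passes from [N] to [K] because the cross terms in [|K x|^2]
  and
    [|K' x|^2] are the same; the conclusion then is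
    [|K x|^2 = <x, K' K x> <= |x| |K' K x| <= |x| |K K x|]. *)
Lemma hyponormal_affine (N N' K : {linear H -> H}) (a c : R[i]) :
  (forall u v, hdot (N u) v = hdot u (N' v)) ->
  (forall x, rnorm (N' x) <= rnorm (N x)) ->
  (forall x, K x = a *: x + c *: N x) ->
  forall x, rnorm (K x) ^+ 2 <= rnorm (K (K x)) * rnorm x.
Proof.
move=> NN' N'N eK x.
pose K' y := Num.conj a *: y + Num.conj c *: N' y.
have KK' u v : hdot (K u) v = hdot u (K' v).
  by rewrite eK /K' hdotDl hdotDr !hdotZl !hdotZr !conjCK NN'.
have K'K y : rnorm (K' y) <= rnorm (K y).
  rewrite -(@ler_pXn2r _ 2)// ?nnegrE ?rnorm_ge0// eK !rnorm_sqrD !rnormZ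
    !modc_conj.
  rewrite (_ : rdot (Num.conj a *: y) _ = rdot (a *: y) (c *: N y)).
    rewrite lerD2l !exprMn ler_wpM2l ?sqr_ge0// ler_pXn2r ?nnegrE ?rnorm_ge0//.
  rewrite /rdot !hdotZl !hdotZr conjCK -NN' (hdotC (N y)).
  rewrite -[X in _ * (X * _)]conjCK -!rmorphM/=.
  by case: (a * _).
rewrite rnorm_sqr /rdot KK' -/(rdot _ _) (le_trans (rdot_le _ _))// mulrC.
by rewrite ler_wpM2r ?rnorm_ge0.
Qed.

End Hyponormal.

Section Resolvent.
Variables (R : realType) (H : hilbertType R).
Implicit Types (G S T A : operator H) (B : {linear H -> H}) (z : R[i]).

Lemma resolvent_bound T z B : is_resolvent T z B ->
  exists2 M : R, 0 <= M & forall x, rnorm (B x) <= M * rnorm x.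
Proof. by move=> [/continuous_linear_rnorm]. Qed.

Lemma resolvent_app T z B x : is_resolvent T z B -> T (B x) = x + z *: B x.
Proof. by move=> [_ /(_ x)[_ e] _]; rewrite -[X in X + _]e subrK. Qed.

Lemma resolvent_inj T z B x : is_resolvent T z B -> B x = 0 -> x = 0.
Proof.
move=> rB Bx; have := resolvent_app x rB.
by rewrite Bx operator_map0 scaler0 addr0.
Qed.

(** In other words [B'] is a right inverse of [A - z'], [z'] being the conjugate
    of [z]; this links the abstract adjoint of [B] with the given adjoint of
    [G]. *)
Lemma adjoint_resolvent G A z B (B' : {linear H -> H}) :
  is_adjoint G A -> is_resolvent G z B ->
  (forall u v, hdot (B u) v = hdot u (B' v)) ->
  forall w, dom A (B' w) /\ A (B' w) = w + Num.conj z *: B' w.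
Proof.
move=> adj [_ _ BG] BB' w; apply/adj => u Gu.
rewrite hdotDr hdotZr conjCK -[in hdot u w](BG u Gu) BB' hdotBl hdotZl.
by rewrite subrK.
Qed.

(** For [u] in the domain of [A G = G A] one has
    [<G u, G u> = <u, A G u> = <u, G A u> = <A u, A u>], and shifting by [z]
    adds the same cross terms on both sides. *)
Lemma normal_shift_norm G A z u : is_adjoint G A ->
  operator_eq (operator_comp A G) (operator_comp G A) ->
  dom G u -> dom A (G u) ->
  [/\ dom A u, rnorm (A u - Num.conj z *: u) = rnorm (G u - z *: u) &
      forall x, dom G x -> hdot (G x) u = hdot x (A u)].
Proof.
move=> adj [domE appE] Gu AGu.
have dAG : dom (operator_comp A G) u by split.
have := dAG; rewrite domE => -[Au GAu].
have adjx v x : dom A v -> dom G x -> hdot (G x) v = hdot x (A v).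
  by move=> Av; have [/(_ (conj Av erefl))h _] := adj v (A v) => /h.
split=> //; last by move=> x; exact: adjx.
have eGA : rnorm (A u) ^+ 2 = rnorm (G u) ^+ 2.
  rewrite !rnorm_sqr /rdot adjx// -[A (G u)]/(operator_comp A G u) appE//=.
  by rewrite [in RHS]hdotC adjx// -hdotC.
apply/eqP; rewrite -(@eqrXn2 _ 2)// ?rnorm_ge0//; apply/eqP.
rewrite !rnorm_sqrB eGA !rnormZ modc_conj; congr (_ - _ * _ + _).
rewrite /rdot !hdotZr adjx// (hdotC (A u)) -rmorphM/=.
by case: (_ * _).
Qed.

(** Write [h = (G - z) u] with [u] in the domain of [A G]. Then [B h = u = B' y]
    with [y = (A - z') u] of the same length as [h], so
    [<B' x, h> = <B x, y>] is at most [|B x| |h|] in absolute value. The bound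
    on [B' x] follows because such [h] are dense. Indeed [h] qualifies when
    [G B h] is in the range of [B'], in particular when [P h] is, where
    [P = B' B + (G B)' (G B)]; and [P] is invertible while the range of [B']
    is dense. *)
Lemma normal_resolvent_hyponormal G z B (B' : {linear H -> H}) (M : R) :
  normal_operator G -> is_resolvent G z B -> 0 <= M ->
  (forall x, rnorm (B x) <= M * rnorm x) ->
  (forall x, rnorm (B' x) <= M * rnorm x) ->
  (forall u v, hdot (B u) v = hdot u (B' v)) ->
  forall x, rnorm (B' x) <= rnorm (B x).
Proof.
move=> [_ _ [A [adj comm]]] rB M0 BM B'M BB' x.
have [C eC] := affine_of B 1 z; have [C' eC'] := affine_of B' 1 (Num.conj z).
have GB h : G (B h) = C h by rewrite eC scale1r; exact: resolvent_app.
have domB h : dom G (B h) by have [_ /(_ h)[]] := rB.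
have CC' u v : hdot (C u) v = hdot u (C' v).
  by rewrite eC eC' !scale1r hdotDl hdotDr hdotZl hdotZr conjCK BB'.
have [|P eP] := @linear_of _ _ (fun h => B' (B h) + C' (C h)).
  by move=> a u v; rewrite !linearP scalerDr addrACA.
pose q := modc z; have q0 : 0 <= q by exact: modc_ge0.
have CM h : rnorm (C h) <= (1 + q * M) * rnorm h.
  rewrite eC scale1r (le_trans (rnormD_le _ _))// rnormZ -/q.
  by have := BM h; have := rnorm_ge0 h; nra.
have C'M h : rnorm (C' h) <= (1 + q * M) * rnorm h.
  rewrite eC' scale1r (le_trans (rnormD_le _ _))// rnormZ modc_conj -/q.
  by have := B'M h; have := rnorm_ge0 h; nra.
have qM : 0 <= 1 + q * M by rewrite addr_ge0 ?mulr_ge0.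
have PM h : rnorm (P h) <= (M ^+ 2 + (1 + q * M) ^+ 2) * rnorm h.
  rewrite eP (le_trans (rnormD_le _ _))// mulrDl !expr2 -!mulrA; apply: lerD.
    by rewrite (le_trans (B'M _))// ler_wpM2l.
  by rewrite (le_trans (C'M _))// ler_wpM2l.
have Pm h : (1 + q ^+ 2)^-1 * rnorm h ^+ 2 <= rdot (P h) h.
  have q1 : 0 < 1 + q ^+ 2 by rewrite ltr_pwDl// sqr_ge0.
  rewrite ler_pdivrMl// eP rdotDl !(rdotC _ h) /rdot -BB' -CC' -!/(rdot _ _).
  rewrite -!rnorm_sqr.
  have : rnorm h <= rnorm (C h) + q * rnorm (B h).
    rewrite -rnormZ -[in X in _ <= X](rnormN (z *: _)).
    by rewrite (le_trans _ (rnormD_le _ _))// eC scale1r addrK.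
  have := rnorm_ge0 h; have := rnorm_ge0 (C h); have := rnorm_ge0 (B h).
  move: (rnorm h) (rnorm (C h)) (rnorm (B h)) => t c b b0 c0 t0 tcb.
  have : t ^+ 2 <= (c + q * b) ^+ 2 by rewrite ler_pXn2r ?nnegrE ?addr_ge0
    ?mulr_ge0.
  by move/le_trans; apply; have := sqr_ge0 (b - q * c); lra.
have m0 : 0 < (1 + q ^+ 2)^-1 by rewrite invr_gt0 ltr_pwDl// sqr_ge0.
have [D [DP PD DM]] := coercive_inverse m0 PM Pm.
have AB' := adjoint_resolvent adj rB BB'.
have core w : rdot (B' x) (D (B' w)) <= rnorm (B x) * rnorm (D (B' w)).
  set h := D (B' w).
  have Ch : C h = B' (w - B h - Num.conj z *: C h).
    have : P h = B' w by rewrite /h DP.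
    rewrite eP eC' scale1r => e;
      rewrite linearB/= linearB/= -e [B' (_ *: _)]linearZ/=.
    by rewrite (addrC (B' (B h))) !addrK.
  have [|Au Auz adju] := normal_shift_norm z adj comm (domB h).
    by rewrite GB Ch; have [] := AB' (w - B h - Num.conj z *: C h).
  set y := A (B h) - _ in Auz.
  have B'y : B' y = B h.
    apply: hdot_ext => v; rewrite -BB' hdotBr hdotZr conjCK -adju//.
    by rewrite -hdotZl -hdotBl GB eC scale1r addrK.
  have -> : rdot (B' x) h = rdot (B x) y.
    by rewrite rdotC [RHS]rdotC /rdot (hdotC y) BB' B'y -hdotC BB'.
  rewrite (le_trans (rdot_le _ _))// Auz (_ : _ - _ = h)//.
  by rewrite GB eC scale1r addrK.
have dense_B' : forall x (e : R), 0 < e -> exists2 v, range B' v & rnorm (x -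
  v) < e.
  apply: orthocomplement0_dense.
    split; first by exists 0; rewrite ?linear0.
    by move=> a _ _ [u _ <-] [v _ <-]; exists (a *: u + v); rewrite ?linearP.
  move=> v hv; apply: (resolvent_inj rB); apply: hdot_ext => w.
  rewrite hdotC BB' -hdotC hv; last by exists w.
  by rewrite linear0r.
set g := B' x.
have dense_D (e : R) : 0 < e -> exists w, rnorm (g - D (B' w)) < e.
  move=> e0; have [|_ [w _ <-] hw] := dense_B' (P g) ((1 + q ^+ 2)^-1 * e).
    exact: mulr_gt0.
  exists w; rewrite -[g in X in X < _]PD -linearB/=.
  by rewrite (le_lt_trans (DM _))// ltr_pdivrMl.
have := rnorm_ge0 g; rewrite le_eqVlt => /predU1P[<-|g0];
  first exact: rnorm_ge0.
rewrite -(ler_pM2r g0) -expr2; apply/ler_addgt0Pr => e e0.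
have := rnorm_ge0 (B x) => Bx0.
have [|w hw] := dense_D (e / (rnorm (B x) + rnorm g)).
  by rewrite divr_gt0// ltr_wpDl.
move: (D _) (core w) hw => h hcore; rewrite ltr_pdivlMr ?ltr_wpDl// => hw.
have -> : rnorm g ^+ 2 = rdot g h + rdot g (g - h).
  by rewrite -rdotDr rnorm_sqr addrCA subrr addr0.
have := rdot_le g (g - h).
have : rnorm h <= rnorm g + rnorm (g - h).
  rewrite -[in X in _ <= _ + X]rnormN -[X in rnorm X <= _](subrK g) addrC.
  by rewrite (le_trans (rnormD_le _ _))// opprB.
move/(ler_wpM2l Bx0); lra.
Qed.

End Resolvent.

(** * Resolvent estimates and perturbation *)

Section Perturbation.
Variables (R : realType) (H : hilbertType R).
Implicit Types (G S T : operator H) (B : {linear H -> H}) (z : R[i]).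

(** [(G - z - c^-1) B = - c^-1 (B - c)], so the inverse of the left factor
  bounds
    [B - c] below: nonzero spectral values of [B] are the numbers [(l - z)^-1]
    with [l] in the spectrum of [G]. *)
Lemma resolvent_bounded_below G z B (c : R[i]) : is_resolvent G z B ->
  c != 0 -> resolvent_set G (z + c^-1) ->
  exists2 d : R, 0 < d & forall y, d * rnorm y <= rnorm (B y - c *: y).
Proof.
move=> rB c0 [Bw rBw]; have [M M0 BM] := resolvent_bound rBw.
have c1 := modc_gt0 c0.
pose L := 1 + M / modc c.
have L0 : 0 < L by rewrite ltr_pwDl// divr_ge0// ltW.
exists (modc c / L) => [|y]; first exact: divr_gt0.
have [_ /(_ y)[dB _] _] := rB.
have [_ _ /(_ _ dB)] := rBw.
have -> : G (B y) - (z + c^-1) *: B y = - c^-1 *: (B y - c *: y).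
  rewrite (resolvent_app y rB) scalerDl opprD addrA addrK scalerBr scalerA.
  by rewrite mulNr mulVf// scaleN1r opprK scaleNr addrC.
move=> e; have := BM (- c^-1 *: (B y - c *: y)).
rewrite e rnormZ modcN modcV mulrA => h.
rewrite mulrAC ler_pdivrMr// -rnormZ.
rewrite -{1}(subKr (B y) (c *: y)) (le_trans (rnormD_le _ _))// rnormN.
by rewrite /L; move: (modc c)^-1 h => k; lra.
Qed.

(** [paranormal_norm_le] for [B] and for [K = G B = 1 + z B]. By
    [resolvent_bounded_below], the value [c] corresponds to the spectral value
    [l = z + c^-1] for [B] and to [l = c z / (c - 1)] for [K]. The condition
    [s <= 1] covers the value [c = 1] of [K], to which no [l] corresponds. *)
Lemma normal_resolvent_bounds G z B (s : R) : normal_operator G ->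
  is_resolvent G z B -> 0 < s <= 1 -> z != 0 ->
  (forall l, spectrum G l -> s * modc z <= modc (l - z)) ->
  (forall l, spectrum G l -> s * modc l <= modc (l - z)) ->
  forall x, rnorm (B x) <= (s * modc z)^-1 * rnorm x /\
            rnorm (G (B x)) <= s^-1 * rnorm x.
Proof.
move=> nG rB /andP[s0 s1] z0 far_z far_l x.
have r0 := modc_gt0 z0.
have [M M0 BM] := resolvent_bound rB.
have [B' [BB' B'M]] := bounded_adjoint M0 BM.
have B'B := normal_resolvent_hyponormal nG rB M0 BM B'M BB'.
have resolvent_near c : c != 0 -> (forall l, l = z + c^-1 -> ~ spectrum G l) ->
    resolvent_set G (z + c^-1).
  by move=> c0 h; apply: contrapT; exact: h.
split.
  apply: (paranormal_norm_le BM).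
  - by apply: (hyponormal_affine BB' B'B (a := 0) (c := 1)) => y;
      rewrite scale0r add0r scale1r.
  - by rewrite invr_gt0 mulr_gt0.
  - move=> c hc.
    have c0 : c != 0.
      apply: contraTneq hc => ->; rewrite /modc normr0 -leNgt invr_ge0.
      by rewrite mulr_ge0// ltW.
    apply: (resolvent_bounded_below rB c0); apply: resolvent_near =>
      // l -> /far_z.
    rewrite addrAC subrr add0r modcV.
    by rewrite invf_plt ?posrE ?mulr_gt0 ?modc_gt0// in hc; rewrite leNgt hc.
have [K eK] := affine_of B 1 z.
have KG y : G (B y) = K y by rewrite eK scale1r; exact: resolvent_app.
rewrite KG; apply: (@paranormal_norm_le _ _ K (1 + modc z * M)).
- move=> y; rewrite eK scale1r (le_trans (rnormD_le _ _))// rnormZ.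
  by have := BM y; nra.
- exact: hyponormal_affine BB' B'B eK.
- by rewrite invr_gt0.
- move=> c hc.
  have cs : 1 < s * modc c by rewrite mulrC -ltr_pdivrMr// mul1r.
  have c1 : 1 < modc c by have := modc_ge0 c; nra.
  have cN1 : c - 1 != 0.
    by rewrite subr_eq0; apply: contraTneq c1 => ->; rewrite modc1 ltxx.
  have d0 : (c - 1) / z != 0 by rewrite mulf_neq0// invr_eq0.
  have [|d dp hd] := resolvent_bounded_below rB d0.
    apply: resolvent_near => // l el /far_l; apply/negP; rewrite -ltNge.
    have -> : l - z = z / (c - 1) by rewrite el addrAC subrr add0r invf_div.
    have -> : l = c * (z / (c - 1)) by rewrite el; field; rewrite z0 cN1.
    rewrite (modcM c) mulrA ltr_pMl//; apply: modc_gt0.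
    by rewrite mulf_neq0// invr_eq0.
  exists (modc z * d) => [|y]; first exact: mulr_gt0.
  have -> : K y - c *: y = z *: (B y - ((c - 1) / z) *: y).
    rewrite eK scale1r scalerBr scalerA mulrC divfK// scalerBl scale1r opprB.
    by rewrite addrAC addrC.
  by rewrite rnormZ -mulrA ler_wpM2l// ltW.
Qed.

(** [T - z = (1 + S B) (G - z)], and [1 + S B] is coercive. *)
Lemma resolvent_perturbation G S z B (q : R) : is_resolvent G z B ->
  dom G `<=` dom S -> q < 1 ->
  (forall x, rnorm (S (B x)) <= q * rnorm x) ->
  exists D BT : {linear H -> H},
    [/\ continuous D, forall x, BT x = B (D x) &
        is_resolvent (operator_add G S) z BT].
Proof.
move=> rB GS q1 SB.
have [M M0 BM] := resolvent_bound rB; have [_ GB BG] := rB.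
have dB x : dom G (B x) by have [] := GB x.
have [|P eP] := @linear_of _ _ (fun x => x + S (B x)).
  move=> a u v; rewrite linearP/= app_linear; [|by apply: GS..].
  by rewrite scalerDr addrACA.
have SBd x : - (q * rnorm x ^+ 2) <= rdot (S (B x)) x.
  have := rdot_le (- S (B x)) x; rewrite rdotNl rnormN => h.
  by rewrite lerNl (le_trans h)// expr2 mulrA ler_wpM2r ?rnorm_ge0.
have [| |x|D [PD DP DM]] := @coercive_inverse _ _ P (1 - q) (1 + q).
- by lra.
- by move=> x; rewrite eP (le_trans (rnormD_le _ _))// mulrDl mul1r lerD2l.
- by rewrite eP rdotDl -rnorm_sqr; have := SBd x; lra.
have m0 : 0 <= (1 - q)^-1 by rewrite invr_ge0; lra.
have [|BT eBT] := @linear_of _ _ (B \o D); first exact: linearP.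
exists D, BT; split=> //.
  by apply/continuous_linear_rnorm; exists (1 - q)^-1.
split.
- apply/continuous_linear_rnorm; exists (M * (1 - q)^-1) => [|x].
    exact: mulr_ge0.
  by rewrite eBT -mulrA (le_trans (BM _))// ler_wpM2l.
- move=> v; rewrite eBT/=; split; first by split=> //; exact: GS.
  rewrite addrAC; have [_ ->] := GB (D v).
  by have := PD v; rewrite eP.
- move=> u [Gu Su]; rewrite eBT/= -[X in _ = X](BG u Gu); congr (B _).
  by rewrite -[RHS]DP eP (BG u Gu) addrAC.
Qed.

Lemma subordinate_resolvent_bound G S z B (p b s : R) : normal_operator G ->
  is_resolvent G z B -> 0 < s <= 1 -> z != 0 -> 0 <= p < 1 ->
  (forall l, spectrum G l -> s * modc z <= modc (l - z)) ->
  (forall l, spectrum G l -> s * modc l <= modc (l - z)) ->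
  subordination_constants p G S b ->
  forall x, rnorm (S (B x)) <= b / (s * modc z `^ (1 - p)) * rnorm x.
Proof.
move=> nG rB s01 z0 /andP[p0 p1] far_z far_l [b0 hb] x.
have [Bx GBx] := normal_resolvent_bounds nG rB s01 z0 far_z far_l x.
have /andP[s0 s1] := s01; have r0 := modc_gt0 z0.
have [_ /(_ x)[dB _] _] := rB.
apply: (le_trans (hb _ dB)); rewrite -!mulrA ler_wpM2l//.
have q0 : 0 <= 1 - p by lra.
have x0 := rnorm_ge0 x.
have i0 : 0 <= s^-1 by rewrite invr_ge0 ltW.
have j0 : 0 <= (modc z)^-1 by rewrite invr_ge0 ltW.
apply: (@le_trans _ _ ((s^-1 * (modc z)^-1 * rnorm x) `^ (1 - p) * (s^-1 *
  rnorm x) `^ p)).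
  rewrite -invfM; apply: ler_pM; rewrite ?powR_ge0//; apply: ge0_ler_powR => //.
  - exact: rnorm_ge0.
  - by rewrite nnegrE invfM !mulr_ge0.
  - exact: rnorm_ge0.
  - by rewrite nnegrE mulr_ge0.
have collect (t : R) : 0 <= t -> t `^ (1 - p) * t `^ p = t.
  move=> t0; rewrite -powRD; first by rewrite subrK powRr1.
  by rewrite subrK oner_eq0.
rewrite !powRM ?mulr_ge0//.
rewrite (_ : _ * _ = (s^-1 `^ (1 - p) * s^-1 `^ p) * ((modc z)^-1 `^ (1 - p) *
  (rnorm x `^ (1 - p) * rnorm x `^ p))); last by ring.
rewrite !collect// invfM -!mulrA.
by rewrite -powRN -(@powR_inv1 _ (modc z)) ?modc_ge0// -powRrM mulN1r.
Qed.

Lemma subordinate_perturbation G S z (p b s : R) : normal_operator G ->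
  dom G `<=` dom S -> 0 < s <= 1 -> z != 0 -> 0 <= p < 1 ->
  (forall l, spectrum G l -> s * modc z <= modc (l - z)) ->
  (forall l, spectrum G l -> s * modc l <= modc (l - z)) ->
  subordination_constants p G S b -> b < s * modc z `^ (1 - p) ->
  exists B D BT : {linear H -> H},
    [/\ is_resolvent G z B, continuous D, forall x, BT x = B (D x) &
        is_resolvent (operator_add G S) z BT].
Proof.
move=> nG GS s01 z0 p01 far_z far_l hb bs.
have [B rB] : resolvent_set G z.
  apply: contrapT => /far_z; rewrite subrr /modc normr0/= leNgt.
  by rewrite mulr_gt0// ?modc_gt0//; case/andP: s01.
have SB := subordinate_resolvent_bound nG rB s01 z0 p01 far_z far_l hb.
have /andP[s0 _] := s01.
have [|D [BT [cD eBT rBT]]] := resolvent_perturbation rB GS _ SB.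
  by rewrite ltr_pdivrMr ?mul1r// mulr_gt0// powR_gt0// modc_gt0.
by exists B, D, BT.
Qed.

(** The resolvent identity [B = B0 (1 + (z - z0) B)] exhibits [BT = B D] as [B0]
    after a bounded operator. *)
Lemma compact_resolvent_transfer G z0 z B0 B (D BT : {linear H -> H}) :
  is_resolvent G z0 B0 -> compact_operator B0 ->
  is_resolvent G z B -> continuous D -> (forall x, BT x = B (D x)) ->
  compact_operator BT.
Proof.
move=> rB0 cB0 rB /continuous_linear_rnorm[L L0 DL] eBT X bX.
have [M M0 BM] := resolvent_bound rB.
have fact x : B (D x) = B0 (D x + (z - z0) *: B (D x)).
  have [_ GB _] := rB; have [_ _ B0G] := rB0.
  have [dB e] := GB (D x).
  rewrite -[LHS](B0G _ dB) (resolvent_app _ rB); congr (B0 _).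
  by rewrite scalerBl addrA.
pose F x := D x + (z - z0) *: B (D x).
have -> : BT @` X = B0 @` (F @` X).
  by rewrite image_comp; apply: eq_imagel => x _; rewrite eBT fact.
apply: cB0; have [K /= K0 XK] := pinfty_ex_gt0 bX.
exists ((L + modc (z - z0) * (M * L))%:C * K); split.
  by rewrite rpredM ?(gtr0_real K0)//; apply/complex_realP;
    exists (L + modc (z - z0) * (M * L)).
move=> r /ltW Kr _ [x Xx <-] /=; apply: le_trans Kr.
apply: (@le_trans _ _ ((L + modc (z - z0) * (M * L))%:C * `|x|)); last first.
  rewrite ler_wpM2l//; last exact: XK.
  by rewrite ler0c addr_ge0 ?mulr_ge0 ?modc_ge0.
rewrite -!rnormE -rmorphM/= lecR (le_trans (rnormD_le _ _))// rnormZ mulrDl.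
apply: lerD => //; rewrite -!mulrA ler_wpM2l ?modc_ge0//.
by rewrite (le_trans (BM _))// ler_wpM2l.
Qed.
End Perturbation.

(** * Rays and parabolas *)

Section Rays.
Variable R : realType.
Implicit Types (z w l : R[i]) (t s : R).

Lemma modc_expi t : modc (expi t) = 1.
Proof.
by apply/eqP; rewrite -(@eqrXn2 _ 2)// ?modc_ge0// sqr_modc/= cos2Dsin2 expr1n.
Qed.

Lemma expi_neq0 t : expi t != 0.
Proof.
by apply/eqP => e0; have /eqP := modc_expi t;
  rewrite e0 /modc normr0 eq_sym oner_eq0.
Qed.

Lemma expiV t : (expi t)^-1 = cos t -i* sin t.
Proof.
apply: (mulfI (expi_neq0 t)); rewrite divff ?expi_neq0// /expi.
rewrite /GRing.mul/= mulrN opprK mulrN -!expr2 cos2Dsin2.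
by rewrite (mulrC (sin t)) addNr.
Qed.

(** In the coordinate [w = z / e^(it)] the ray is the positive half-line. The
    number [s] is at most the sine of the angle between [z] and the ray when
      that
    angle is acute; [s |l| <= |l - z|] then says that the quadratic polynomial
    [|l - z|^2 - s^2 l^2] in [l] has no sign change. *)
Lemma ray_distance t s z l : 0 <= s <= 1 ->
  complex.Re (z / expi t) <= 0 \/ s * modc z <= `|complex.Im (z / expi t)| ->
  ray t l -> s * modc z <= modc (l - z) /\ s * modc l <= modc (l - z).
Proof.
move=> /andP[s0 s1] + [u [u0 ->]]; set w := z / expi t => hw.
have zw : z = expi t * w by rewrite /w mulrC divfK// expi_neq0.
clearbody w; rewrite zw -mulrBr !modcM modc_expi !mul1r in hw *.
have le_sqr (a c : R) : 0 <= c -> a ^+ 2 <= c ^+ 2 -> a <= c.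
  by move=> c0 h; nra.
rewrite modc_real//.
have d2 : modc (u%:C - w) ^+ 2 = (u - complex.Re w) ^+ 2 + complex.Im w ^+ 2.
  by rewrite sqr_modc; case: (w) => x y /=; rewrite sub0r sqrrN.
have w2 := sqr_modc w; have w0 := modc_ge0 w.
move: (modc w) w0 w2 hw => m m0 w2.
case: w {zw} d2 w2 => x y /= d2 w2 [x0|ym].
  have h : u ^+ 2 + m ^+ 2 <= modc (u%:C - (x +i* y)) ^+ 2 by rewrite d2 w2;
    nra.
  have s2 : s ^+ 2 <= 1 by nra.
  split; apply: (le_sqr _ _ (modc_ge0 _)); apply: le_trans h; rewrite exprMn.
    by have := ler_wpM2r (sqr_ge0 m) s2; have := sqr_ge0 u; lra.
  by have := ler_wpM2r (sqr_ge0 u) s2; have := sqr_ge0 m; lra.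
have y2 : (s * m) ^+ 2 <= y ^+ 2.
  by rewrite -(real_normK (num_real y)) ler_pXn2r ?nnegrE ?mulr_ge0.
split; apply: (le_sqr _ _ (modc_ge0 _)); rewrite d2.
  by have := sqr_ge0 (u - x); lra.
(* a quadratic in u with nonpositive discriminant *)
have disc : x ^+ 2 <= (1 - s ^+ 2) * m ^+ 2 by move: y2; rewrite exprMn w2; lra.
have s2 : s ^+ 2 <= 1 by nra.
have -> : (u - x) ^+ 2 + y ^+ 2 = u ^+ 2 - 2 * u * x + m ^+ 2 by rewrite w2;
  ring.
rewrite exprMn.
have [e|s2'] := eqVneq (s ^+ 2) 1.
  have : x ^+ 2 <= 0 by move: disc; rewrite e subrr mul0r.
  by rewrite e; have := sqr_ge0 m; nra.
have c0 : 0 < 1 - s ^+ 2 by rewrite subr_gt0 lt_neqAle s2'.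
rewrite -subr_ge0 -(pmulr_rge0 _ c0).
have := sqr_ge0 ((1 - s ^+ 2) * u - x); nra.
Qed.

(** Let [w = x + iy] be [z / e^(it)], of modulus [r]. If [x > 0] and
    [|y| < s r] for [s = beta / r^(1-p)], then [z] is in the region. Indeed
    [s r = beta r^p], and since [s] is small for large [r] the ratio [x / r] is
    so close to 1 that [beta r^p <= alpha x^p]. *)
Lemma outside_parabola (b alpha p : R) : 0 <= b < alpha -> 0 <= p < 1 ->
  exists beta r0 : R, [/\ b < beta, 0 < r0 & forall z, r0 <= modc z ->
    0 < beta / modc z `^ (1 - p) <= 1 /\
    forall t, ~ parabola_region t alpha p z ->
      complex.Re (z / expi t) <= 0 \/
      beta / modc z `^ (1 - p) * modc z <= `|complex.Im (z / expi t)|].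
Proof.
move=> /andP[b0 ba] /andP[p0 p1].
pose beta := (b + alpha) / 2.
have beta0 : 0 < beta by rewrite /beta; lra.
have betaa : beta < alpha by rewrite /beta; lra.
have bbeta : b < beta by rewrite /beta; lra.
clearbody beta.
have a0 : 0 < alpha by lra.
have d0 : 0 < alpha ^+ 2 - beta ^+ 2 by nra.
(* [Q < r^(2(1-p))] is the condition [s ^ 2 < 1 - (beta / alpha) ^ 2], which
   forces [beta / alpha < x / r <= (x / r) ^ p] *)
pose Q := beta ^+ 2 * alpha ^+ 2 / (alpha ^+ 2 - beta ^+ 2).
have eQ : Q * (alpha ^+ 2 - beta ^+ 2) = beta ^+ 2 * alpha ^+ 2.
  by rewrite /Q divfK// gt_eqF.
have Q0 : 0 < Q by rewrite divr_gt0// mulr_gt0// exprn_gt0.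
pose K := 1 + Q; have K0 : 0 < K by rewrite /K; lra.
have q0 : 0 < 1 - p by lra.
exists beta, (K `^ (1 - p)^-1); split; [by [] | exact: powR_gt0 |].
move=> z rz; set r := modc z in rz *.
have r0 : 0 < r by apply: lt_le_trans rz; exact: powR_gt0.
pose rho := r `^ (1 - p).
have Krho : K <= rho.
  have -> : K = (K `^ (1 - p)^-1) `^ (1 - p).
    by rewrite -powRrM mulVf ?powRr1 ?gt_eqF// ltW.
  by apply: ge0_ler_powR; rewrite ?nnegrE ?powR_ge0 ?(ltW q0) ?(ltW r0).
have rho0 : 0 < rho by lra.
rewrite -/rho; set s := beta / rho.
have s0 : 0 < s by rewrite divr_gt0.
have s2 : s ^+ 2 < 1 - (beta / alpha) ^+ 2.
  rewrite /s !expr_div_n.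
  rewrite (_ : 1 - _ = (alpha ^+ 2 - beta ^+ 2) / alpha ^+ 2); last first.
    by field; rewrite gt_eqF.
  rewrite ltr_pdivrMr ?exprn_gt0// mulrAC ltr_pdivlMr ?exprn_gt0// -eQ mulrC.
  by rewrite ltr_pM2l//; move: Krho; rewrite /K; nra.
have k0 : 0 < beta / alpha by rewrite divr_gt0.
split; first by rewrite s0/=; have := sqr_ge0 (beta / alpha); nra.
move=> t out; set w := z / expi t.
have mw : modc w = r by rewrite modcM modcV modc_expi invr1 mulr1.
have [x0|x0] := leP (complex.Re w) 0; [by left | right].
rewrite leNgt; apply/negP => ys; apply: out.
exists (complex.Re w), (complex.Im w); split; first exact: ltW.
  rewrite ltW// (lt_le_trans ys)//.
  have w2 : r ^+ 2 = complex.Re w ^+ 2 + complex.Im w ^+ 2 by rewrite -mw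
    sqr_modc.
  have y2 : complex.Im w ^+ 2 < s ^+ 2 * r ^+ 2.
    by rewrite -exprMn -(real_normK (num_real (complex.Im w))) ltr_pXn2r
      ?nnegrE// mulr_ge0 ?(ltW s0) ?(ltW r0).
  pose c := complex.Re w / r.
  have c0 : 0 < c by rewrite divr_gt0.
  have ec : complex.Re w = c * r by rewrite /c divfK// gt_eqF.
  have r2 : 0 < r ^+ 2 by rewrite exprn_gt0.
  have c1 : c <= 1.
    rewrite ler_pdivrMr// mul1r -(@ler_pXn2r _ 2)// ?nnegrE ?(ltW x0) ?(ltW
      r0)//.
    by rewrite w2 lerDl sqr_ge0.
  have kc : beta / alpha < c.
    rewrite -(@ltr_pXn2r _ 2)// ?nnegrE ?(ltW k0) ?(ltW c0)//.
    by rewrite -(ltr_pM2r r2); rewrite ec exprMn in w2; nra.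
  have cp : c <= c `^ p.
    by apply: ger1_powR; [rewrite c0 | exact: ltW].
  have sr : s * r = beta * r `^ p.
    rewrite /s mulrAC -mulrA; congr (_ * _).
    rewrite -[X in X / _](@powRr1 _ r) ?(ltW r0)// -{1}(subrK p 1) addrC.
    rewrite (addrC p) powRD; last by rewrite subrK oner_eq0.
    by rewrite mulrAC divff ?mul1r// gt_eqF.
  rewrite sr ec powRM ?(ltW c0) ?(ltW r0)// mulrA ler_pM2r ?powR_gt0//.
  by move: kc; rewrite ltr_pdivrMr// mulrC => kc;
    rewrite (le_trans (ltW kc))// ler_pM2l.
by rewrite mulrC (_ : _ +i* _ = w) ?divfK ?expi_neq0//; case: (w).
Qed.

(** The vector [w = 1 + ik] lies on no line through a ray as soon as [k] exceeds
    all the slopes [tan (theta j)]. *)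
Lemma direction_off_rays n (theta : 'I_n -> R) : exists w s,
  [/\ 0 < modc w, 0 < s <= 1 &
    forall j, s * modc w <= `|complex.Im (w / expi (theta j))|].
Proof.
pose k : R := 1 + \sum_j `|tan (theta j)|.
pose w : R[i] := 1 +i* k.
have w0 : 0 < modc w by apply: modc_gt0; rewrite eq_complex/= oner_eq0.
have Imw j : complex.Im (w / expi (theta j)) = k * cos (theta j) - sin (theta
  j).
  by rewrite expiV /=; ring.
have Imw0 j : complex.Im (w / expi (theta j)) != 0.
  rewrite Imw; have [c0|c0] := eqVneq (cos (theta j)) 0.
    rewrite c0 mulr0 sub0r oppr_eq0; apply/eqP => s0.
    by have := cos2Dsin2 (theta j); rewrite c0 s0 expr0n/= addr0 => /eqP;
      rewrite eq_sym oner_eq0.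
  rewrite subr_eq0; apply/eqP => e.
  have : k = tan (theta j) by rewrite /tan -e mulfK.
  rewrite /k (bigD1 j)//=; have := ler_norm (tan (theta j)).
  have : 0 <= \sum_(i < n | i != j) `|tan (theta i)| by apply: sumr_ge0.
  lra.
pose F j := `|complex.Im (w / expi (theta j))| / modc w.
exists w, (\big[Num.min/1]_j F j); split=> //.
  rewrite bigmin_le_id andbT; apply/bigmin_gtP; split=> // j _.
  by rewrite divr_gt0// normr_gt0.
move=> j; rewrite -ler_pdivlMr//; exact: bigmin_le.
Qed.

End Rays.

Theorem theorem4p5 (R : realType) (H : hilbertType R) (n : nat)
  (theta : 'I_n -> R) (p b : R) (G S : operator H)
  (htheta : forall j, 0 <= theta j < 2 * pi)
  (hp : 0 <= p < 1)
  (hG : normal_operator G)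
  (hspec : spectrum G `<=` \bigcup_j ray (theta j))
  (hS : subordinate p G S)
  (hb : subordination_bound p G S b) :
  let T := operator_add G S in
  (forall alpha : R, b < alpha ->
     exists r0 : R, 0 < r0 /\
       spectrum T `<=`
         disc r0 `|` \bigcup_j parabola_region (theta j) alpha p)
  /\ (compact_resolvent G -> compact_resolvent T).
Proof.
have [GS _] := hS; have [bS _] := hb; have [b0 _] := bS.
have perturb z s : 0 < s <= 1 -> z != 0 -> b < s * modc z `^ (1 - p) ->
    (forall j, complex.Re (z / expi (theta j)) <= 0 \/
       s * modc z <= `|complex.Im (z / expi (theta j))|) ->
    exists B D BT : {linear H -> H},
    [/\ is_resolvent G z B, continuous D, forall x, BT x = B (D x) &
        is_resolvent (operator_add G S) z BT].
  move=> s01 z0 bs away.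
  have s01' : 0 <= s <= 1 by case/andP: s01 => /ltW -> ->.
  by apply: (subordinate_perturbation hG GS s01 z0 hp _ _ bS bs) =>
    l /hspec[j _];
    case/(ray_distance s01' (away j)).
move=> T; split.
  move=> alpha ba.
  have [|beta [r0 [bbeta r00 far]]] := @outside_parabola _ b alpha p _ hp.
    by rewrite b0.
  exists r0; split=> // z zT; apply: contrapT => /not_orP[zr out].
  have rz : r0 <= modc z by rewrite leNgt; apply/negP => h; apply: zr;
    rewrite /disc/= -modcE ltcR.
  have z0 : z != 0.
    by apply: contraTneq rz => ->; rewrite /modc normr0 -ltNge.
  have [s01 away] := far z rz.
  have [|j|B [D [BT [_ _ _ rBT]]]] := perturb z _ s01 z0.
  - by rewrite divfK// gt_eqF// powR_gt0// modc_gt0.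
  - by apply: away => zj; apply: out; exists j.
  - by apply: zT; exists BT.
move=> [z0 [B0 [rB0 cB0]]].
have [w [s [w0 s01 away]]] := direction_off_rays theta.
have /andP[s0 _] := s01; have /andP[_ p1] := hp.
pose r := (b / s + 1) `^ (1 - p)^-1.
have c0 : 0 < b / s + 1 by rewrite ltr_wpDl// divr_ge0// ltW.
have r0 : 0 < r by exact: powR_gt0.
pose k := r / modc w; have k0 : 0 < k by exact: divr_gt0.
pose z := k%:C * w.
have mz : modc z = r by rewrite modcM modc_real ?(ltW k0)// divfK// gt_eqF.
have [| |j|B [D [BT [rB cD eBT rBT]]]] := perturb z s s01.
- by apply: contraTneq r0 => e; rewrite -mz e /modc normr0 ltxx.
- rewrite mz /r -powRrM mulVf ?powRr1 ?(ltW c0)//;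
    last by rewrite gt_eqF// subr_gt0.
  by rewrite mulrDr mulr1 mulrC divfK ?gt_eqF// ltrDl.
- right; rewrite mz -mulrA; case: (w / _) (away j) => x y /=.
  rewrite mul0r addr0 normrM (gtr0_norm k0) => h.
  have -> : s * r = k * (s * modc w) by rewrite mulrCA /k divfK// gt_eqF.
  by rewrite ler_pM2l.
exists z, BT; split=> //.
exact: (compact_resolvent_transfer rB0 cB0 rB cD eBT).
Qed.
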